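(* Let $\Bbbk$ be a field of characteristic zero and let $\alpha,\beta,\gamma\in\Bbbk$ with $\beta\neq 0$ be such that $\Bbbk$ contains both roots of the polynomial $t^2-\alpha t-\beta$. If $A=A(\alpha,\beta,\gamma)$ is the down-up algebra with $\gamma\neq 0$, then $A$ has a non-trivial, stably free right ideal.
   Context: For a field $\Bbbk$ and $\alpha,\beta,\gamma\in\Bbbk$, the down-up algebra $A(\alpha,\beta,\gamma)$ is the associative unital $\Bbbk$-algebra generated by $U$ and $D$ subject to the relations $DU^2=\alpha UDU+\beta U^2D+\gamma U$ and $D^2U=\alpha DUD+\beta UD^2+\gamma D$. A right $S$-module $P$ is stably free if $P\oplus S^m\cong S^n$ for some integers $m,n\geq 0$. A non-trivial stably free right ideal of a ring $S$ is a right ideal that is stably free but not free as a right $S$-module. *)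

(* Defs.v *)
From HB Require Import structures.
From mathcomp Require Import all_boot all_algebra.
From mathcomp Require Import finmap boolp monalg.

Set Implicit Arguments.
Unset Strict Implicit.
Unset Printing Implicit Defensive.

Import GRing.Theory.
Import Quotient.
Local Open Scope ring_scope.
Local Open Scope quotient_scope.

(* The two-sided ideal of R generated by a family of relators: the finite sums
   of products a * r * b with r a relator. *)
Section GeneratedIdeal.
Variables (R : nzRingType) (J : Type) (rel_ : J -> R).

Definition in_gen_ideal (x : R) : Prop :=
  exists s : seq (R * J * R), x = \sum_(t <- s) t.1.1 * rel_ t.1.2 * t.2.

Definition gen_ideal : {pred R} := fun x => `[< in_gen_ideal x >].

Lemma gen_idealP x : reflect (in_gen_ideal x) (x \in gen_ideal).
Proof. exact: asboolP. Qed.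

Lemma gen_ideal_gen j : rel_ j \in gen_ideal.
Proof.
by apply/gen_idealP; exists [:: (1, j, 1)]; rewrite big_seq1 /= mul1r mulr1.
Qed.

Lemma gen_ideal_mull a x : x \in gen_ideal -> a * x \in gen_ideal.
Proof.
move=> /gen_idealP[s ->]; apply/gen_idealP.
exists [seq (a * t.1.1, t.1.2, t.2) | t <- s].
by rewrite big_map mulr_sumr; apply: eq_bigr => t _ /=; rewrite !mulrA.
Qed.

Lemma gen_ideal_mulr a x : x \in gen_ideal -> x * a \in gen_ideal.
Proof.
move=> /gen_idealP[s ->]; apply/gen_idealP.
exists [seq (t.1.1, t.1.2, t.2 * a) | t <- s].
by rewrite big_map mulr_suml; apply: eq_bigr => t _ /=; rewrite !mulrA.
Qed.

Lemma gen_ideal_zmod_closed : zmod_closed gen_ideal.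
Proof.
split=> [|x y xI yI].
  by apply/gen_idealP; exists [::]; rewrite big_nil.
have : - y \in gen_ideal by rewrite -mulN1r gen_ideal_mull.
case/gen_idealP: xI => s ->; case/gen_idealP=> s' ->.
by apply/gen_idealP; exists (s ++ s'); rewrite big_cat.
Qed.

HB.instance Definition _ :=
  GRing.isZmodClosed.Build R gen_ideal gen_ideal_zmod_closed.

End GeneratedIdeal.

Section DownUpAlgebra.
Variables (k : fieldType) (al be ga : k).

(* The free associative unital algebra k<U, D>: the monoid algebra of the free
   monoid on two letters, true standing for U and false for D. *)
Local Notation free_UD := {malg k[{fmonom bool}]}.

Fact free_scaleAr c (a b : free_UD) : c *: (a * b) = a * (c *: b).
Proof.
apply/malgP=> m.
rewrite (mcoeffZ c (a * b) m).
rewrite [X in c * X = _](mcoeffMl a b m).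
rewrite (mcoeffMlw _ (fsubset_refl _) (msuppZ_le c b)) mulr_sumr.
apply: eq_bigr => m1 _; rewrite mulr_sumr; apply: eq_bigr => m2 _.
by rewrite (mcoeffZ c b m2) mulrnAr mulrCA.
Qed.

Definition freeU : free_UD := << fmu true >>.
Definition freeD : free_UD := << fmu false >>.

Definition downup_relator (B : lalgType k) (u d : B) (b : bool) : B :=
  if b then
    d * u ^+ 2 - (al *: (u * d * u) + be *: (u ^+ 2 * d) + ga *: u)
  else
    d ^+ 2 * u - (al *: (d * u * d) + be *: (u * d ^+ 2) + ga *: d).

Lemma downup_relator_morph (B C : lalgType k) (f : {lrmorphism B -> C})
    (u d : B) (b : bool) :
  f (downup_relator u d b) = downup_relator (f u) (f d) b.
Proof.
by case: b => /=; rewrite linearB !linearD !linearZ !rmorphM.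
Qed.

Definition downup_ideal : zmodClosed free_UD :=
  gen_ideal (downup_relator freeU freeD).

Definition downup : Type := {quot downup_ideal}.

HB.instance Definition _ := EqQuotient.on downup.
HB.instance Definition _ := Choice.on downup.
HB.instance Definition _ := GRing.Zmodule.on downup.

Implicit Types x y z : downup.

Fact downup_piP (a b : free_UD) :
  reflect (a = b %[mod downup]) (a - b \in downup_ideal).
Proof. exact: (@eqquotP _ (equiv downup_ideal) downup a b). Qed.

Definition downup_one : downup := lift_cst downup 1.
Definition downup_mul : downup -> downup -> downup := lift_op2 downup *%R.
Definition downup_scale (c : k) : downup -> downup :=
  lift_op1 downup ( *:%R c).

Lemma downup_pi1 : \pi_downup 1 = downup_one.
Proof. by rewrite /downup_one; unlock. Qed.

Lemma downup_pi_surj x : exists a : free_UD, x = \pi_downup a.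
Proof. by exists (repr x); rewrite reprK. Qed.

Lemma downup_piD (a b : free_UD) :
  \pi_downup (a + b) = \pi_downup a + \pi_downup b.
Proof. exact: (raddfD (\pi_{quot downup_ideal})). Qed.

Lemma downup_piM (a b : free_UD) :
  \pi_downup (a * b) = downup_mul (\pi_downup a) (\pi_downup b).
Proof.
rewrite /downup_mul; unlock.
apply/downup_piP.
set a' := repr _; set b' := repr _.
have aI : a - a' \in downup_ideal by apply/downup_piP; rewrite reprK.
have bI : b - b' \in downup_ideal by apply/downup_piP; rewrite reprK.
have -> : a * b - a' * b' = (a - a') * b + a' * (b - b').
  by rewrite mulrBl mulrBr addrA subrK.
by apply: rpredD; [exact: gen_ideal_mulr | exact: gen_ideal_mull].
Qed.

Lemma downup_piZ c (a : free_UD) :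
  \pi_downup (c *: a) = downup_scale c (\pi_downup a).
Proof.
rewrite /downup_scale; unlock.
apply/downup_piP; rewrite -scalerBr -[_ - _]mul1r scalerAl.
by apply: gen_ideal_mull; apply/downup_piP; rewrite reprK.
Qed.

Fact downup_mulA : associative downup_mul.
Proof.
move=> x y z; case: (downup_pi_surj x) => a ->.
case: (downup_pi_surj y) => b ->; case: (downup_pi_surj z) => c ->.
by rewrite -!downup_piM mulrA.
Qed.
Fact downup_mul1x : left_id downup_one downup_mul.
Proof. by move=> x; case: (downup_pi_surj x) => a ->;
  rewrite -downup_pi1 -downup_piM mul1r. Qed.
Fact downup_mulx1 : right_id downup_one downup_mul.
Proof. by move=> x; case: (downup_pi_surj x) => a ->;
  rewrite -downup_pi1 -downup_piM mulr1. Qed.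
Fact downup_mulDl : left_distributive downup_mul +%R.
Proof.
move=> x y z; case: (downup_pi_surj x) => a ->.
case: (downup_pi_surj y) => b ->; case: (downup_pi_surj z) => c ->.
by rewrite -downup_piD -!downup_piM -downup_piD mulrDl.
Qed.
Fact downup_mulDr : right_distributive downup_mul +%R.
Proof.
move=> x y z; case: (downup_pi_surj x) => a ->.
case: (downup_pi_surj y) => b ->; case: (downup_pi_surj z) => c ->.
by rewrite -downup_piD -!downup_piM -downup_piD mulrDr.
Qed.

(* The relators have no constant term. *)
Fact downup_one_neq0 : downup_one != 0.
Proof.
have U0 c : (<< fmu c >> : free_UD)@_mone = 0.
  rewrite mcoeffU; case: eqP => // /(congr1 (@fdeg _)).
  by rewrite fdeg1 fdegU.
have cM (a b : free_UD) : (a * b)@_mone = a@_mone * b@_mone.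
  exact: (rmorphM (mcoeff mone)).
have [K [KP KD KN KZ KM]] : exists K : free_UD -> Prop,
    [/\ forall a, K a <-> a@_mone = 0, forall a b, K a -> K b -> K (a + b),
      forall a, K a -> K (- a), forall c a, K a -> K (c *: a)
      & forall a b, K a \/ K b -> K (a * b)].
  exists (fun a => a@_mone = 0); split=> // [a b a0 b0|a a0|c a a0|a b].
  - by rewrite (mcoeffD _ a b) a0 b0 addr0.
  - by rewrite (mcoeffN _ a) a0 oppr0.
  - by rewrite (mcoeffZ c a) a0 mulr0.
  - by rewrite (cM a b) => -[] ->; rewrite ?mul0r ?mulr0.
have KU : K freeU by apply/KP; exact: U0.
have KE : K freeD by apply/KP; exact: U0.
have KR m p q r : K m -> K p -> K q -> K r ->
    K (m - (al *: p + be *: q + ga *: r)).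
  move=> *; apply: (KD) => //; apply: (KN); apply: (KD); last exact: (KZ).
  by apply: (KD); exact: (KZ).
have relK b : K (downup_relator freeU freeD b).
  by case: b; apply: (KR); (exact: KU || exact: KE || apply: (KM));
    [left|right|left|right|left|right];
    rewrite ?expr2; (exact: KU || exact: KE || (apply: (KM); left)).
apply/eqP=> e; have : (1 : free_UD) \in downup_ideal.
  rewrite -[1]subr0; apply/downup_piP; rewrite downup_pi1 e; symmetry.
  by apply: (addrI (\pi_downup 0)); rewrite -downup_piD !addr0.
case/gen_idealP=> s s1; have : K 1.
  rewrite s1; apply: big_ind => [|//|t _]; first by apply/KP; rewrite mcoeff0.
  by apply: (KM); left; apply: (KM); right.
by move/KP/eqP; rewrite mcoeffC eqxx oner_eq0.
Qed.

HB.instance Definition _ := GRing.Zmodule_isNzRing.Build downup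
  downup_mulA downup_mul1x downup_mulx1 downup_mulDl downup_mulDr
  downup_one_neq0.

Fact downup_scaleA c d x :
  downup_scale c (downup_scale d x) = downup_scale (c * d) x.
Proof. by case: (downup_pi_surj x) => a ->; rewrite -!downup_piZ scalerA. Qed.
Fact downup_scale1 : left_id 1 downup_scale.
Proof. by move=> x; case: (downup_pi_surj x) => a ->;
  rewrite -downup_piZ scale1r. Qed.
Fact downup_scaleDr : right_distributive downup_scale +%R.
Proof.
move=> c x y; case: (downup_pi_surj x) => a ->.
case: (downup_pi_surj y) => b ->.
by rewrite -downup_piD -!downup_piZ -downup_piD scalerDr.
Qed.
Fact downup_scaleDl x : {morph downup_scale^~ x : c d / c + d}.
Proof.
move=> c d; case: (downup_pi_surj x) => a ->.
by rewrite -!downup_piZ -downup_piD scalerDl.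
Qed.

HB.instance Definition _ := GRing.Zmodule_isLmodule.Build k downup
  downup_scaleA downup_scale1 downup_scaleDr downup_scaleDl.

Definition downup_pi (a : free_UD) : downup := \pi_downup a.

Fact downup_pi_monoid_morphism : monoid_morphism downup_pi.
Proof. split; [exact: downup_pi1 | exact: downup_piM]. Qed.

Fact downup_pi_linear : linear downup_pi.
Proof.
by move=> c a b; rewrite /downup_pi downup_piD downup_piZ.
Qed.

HB.instance Definition _ :=
  GRing.isLinear.Build k free_UD downup *:%R downup_pi downup_pi_linear.
HB.instance Definition _ :=
  GRing.isMonoidMorphism.Build free_UD downup downup_pi
    downup_pi_monoid_morphism.

Fact downup_scaleAl c x y : c *: (x * y) = (c *: x) * y.
Proof.
case: (downup_pi_surj x) => a ->; case: (downup_pi_surj y) => b ->.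
rewrite -/(downup_pi a) -/(downup_pi b).
by rewrite -rmorphM -!linearZ /= -rmorphM scalerAl.
Qed.

HB.instance Definition _ :=
  GRing.Lmodule_isLalgebra.Build k downup downup_scaleAl.

Fact downup_scaleAr c x y : c *: (x * y) = x * (c *: y).
Proof.
case: (downup_pi_surj x) => a ->; case: (downup_pi_surj y) => b ->.
rewrite -/(downup_pi a) -/(downup_pi b).
by rewrite -rmorphM -!linearZ /= -rmorphM free_scaleAr.
Qed.

HB.instance Definition _ :=
  GRing.Lalgebra_isAlgebra.Build k downup downup_scaleAr.

HB.instance Definition _ := GRing.RMorphism.on downup_pi.

Definition downupU : downup := downup_pi freeU.
Definition downupD : downup := downup_pi freeD.

Lemma downup_relator0 b : downup_relator downupU downupD b = 0.
Proof.
rewrite -(downup_relator_morph downup_pi) -(raddf0 downup_pi).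
by apply/downup_piP; rewrite subr0; exact: gen_ideal_gen.
Qed.

Lemma downup_relDUU : downupD * downupU ^+ 2 =
  al *: (downupU * downupD * downupU) + be *: (downupU ^+ 2 * downupD)
  + ga *: downupU.
Proof. exact: subr0_eq (downup_relator0 true). Qed.

Lemma downup_relDDU : downupD ^+ 2 * downupU =
  al *: (downupD * downupU * downupD) + be *: (downupU * downupD ^+ 2)
  + ga *: downupD.
Proof. exact: subr0_eq (downup_relator0 false). Qed.

End DownUpAlgebra.

(* A right S-module is a left module over the converse ring S^c; in (S^c)^o,
   which is S acting on itself, s *: x is x * s computed in S.  A right ideal
   of S is thus a submodule of (S^c)^o. *)
Definition right_ideal (S : nzRingType) := submodClosed (S^c)^o.

Section Submodule.
Variables (R : nzRingType) (V : lmodType R) (I : submodClosed V).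

Record submodule : predArgType :=
  Submodule { submodule_val : V; submodule_valP : submodule_val \in I }.

HB.instance Definition _ := [isSub for submodule_val].
HB.instance Definition _ := [Choice of submodule by <:].
HB.instance Definition _ := [SubChoice_isSubLmodule of submodule by <:].

End Submodule.

(* The free module on a set J, of arbitrary cardinality, is the module
   {malg R[J]} of finitely supported functions from J to R. *)
Definition free_module (R : nzRingType) (P : lmodType R) : Prop :=
  exists (J : choiceType) (f : {linear {malg R[J]} -> P}), bijective f.

Definition stably_free (R : nzRingType) (P : lmodType R) : Prop :=
  exists (m n : nat) (f : {linear (P * 'rV[R]_m)%type -> 'rV[R]_n}),
    bijective f.

Definition nontrivial_stably_free_right_ideal (S : nzRingType)
    (I : right_ideal S) : Prop :=
  stably_free (submodule I) /\ ~ free_module (submodule I).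

(* Main.v *)
From HB Require Import structures.
Require Import Defs.
From mathcomp Require Import all_boot all_order all_algebra.
From mathcomp Require Import boolp functions finmap monalg zify ring.
From mathcomp Require mpoly.
Set Implicit Arguments.
Unset Strict Implicit.
Unset Printing Implicit Defensive.
Import Order.TTheory GRing.Theory Num.Theory.
Local Open Scope ring_scope.
Local Open Scope quotient_scope.

(** Write the polynomial as (t - r)(t - s), so that alpha = r + s and
    beta = - r s, and let A be the algebra and W = D U - r U D.  The first
    defining relation says that W U = U W' with W' = s W + gamma.  Hence
      gamma = W (U - s) - (U - 1) W',
    and since gamma is invertible, (W, U - 1) is a unimodular row.  The right
    ideal of the theorem is the colon ideal I = {a | W a is in (U - 1) A}.

    I is stably free (stably_free_colon).  The row (W, U - 1) defines a split
    surjection from A^2 onto A; as U - 1 is left regular, projection on the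
    first coordinate identifies its kernel with I, so I + A = A^2.  Regularity
    comes from the Z-grading of A with U in degree 1 and D in degree -1
    (lreg_U_sub1).

    I is not free.  The augmentation sending U and D to 0 bounds the rank of a
    free I by 1, so a free I is principal (free_colon_principal).  Suppose
    I = g A.  The polynomial ring P = k[h0, h1] has the automorphism sigma with
    sigma(h0) = h1 and sigma(h1) = alpha h1 + beta h0 + gamma (this needs
    beta <> 0), and A maps to the skew Laurent ring P[U, U^-1; sigma] by
    D |-> U^-1 h0; then W goes to w = h1 - r h0, a nonunit of P.  I contains
      U W - W'   and   (U - s) (U - 1),
    both multiples of g.  The second has leading coefficient 1, so the leading
    coefficient of g is a unit of P; the first has exactly two nonzero
    homogeneous components, in degrees 0 and 1, so g has at most two, in
    consecutive degrees.  On P = P[U, U^-1; sigma] / (U - 1), where U acts as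
    sigma, w g = 0 because W g is in (U - 1) A.  This equation has at most two
    terms, sigma^n(w) p + sigma^(n+1)(w) q = 0 with q the leading coefficient;
    sigma^(n+1)(w) = s sigma^n(w) + gamma then makes sigma^n(w) divide the unit
    gamma q, which is absurd (no_generator). *)

(** * Unbundled linear maps *)

Lemma linear_fun_sum (K : nzRingType) (V W : lmodType K) (f : V -> W)
    (f_lin : linear f) (I : Type) (s : seq I) (F : I -> V) :
  f (\sum_(i <- s) F i) = \sum_(i <- s) f (F i).
Proof.
pose g := GRing.isLinear.Build K V W *:%R f f_lin.
pose fl : {linear V -> W} := HB.pack f g.
exact: (linear_sum fl).
Qed.

Lemma linear_fun0 (K : nzRingType) (V W : lmodType K) (f : V -> W)
    (f_lin : linear f) : f 0 = 0.
Proof.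
pose g := GRing.isLinear.Build K V W *:%R f f_lin.
by pose fl : {linear V -> W} := HB.pack f g; exact: (linear0 fl).
Qed.

Lemma linear_funZ (K : nzRingType) (V W : lmodType K) (f : V -> W)
    (f_lin : linear f) c v : f (c *: v) = c *: f v.
Proof. by rewrite -[c *: v]addr0 f_lin linear_fun0 // addr0. Qed.

Lemma linear_funB (K : nzRingType) (V W : lmodType K) (f : V -> W)
    (f_lin : linear f) v w : f (v - w) = f v - f w.
Proof. by rewrite addrC -scaleN1r f_lin scaleN1r addrC. Qed.

Lemma linear_fun_comb (K : nzRingType) (V W : lmodType K) (f : V -> W)
    (f_lin : linear f) a b c m p q r :
  f (m - (a *: p + b *: q + c *: r)) =
  f m - (a *: f p + b *: f q + c *: f r).
Proof.
rewrite addrC -scaleN1r f_lin -addrA !f_lin (linear_funZ f_lin).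
by rewrite scaleN1r [RHS]addrC !addrA.
Qed.

(** * Right representations of the down-up algebra *)

Section RightRepresentation.
Variables (k : fieldType) (al be ga : k) (V : lmodType k) (u d : V -> V).
Hypotheses (u_linear : linear u) (d_linear : linear d).
Hypothesis act_DUU : forall v,
  u (u (d v)) = al *: u (d (u v)) + be *: d (u (u v)) + ga *: u v.
Hypothesis act_DDU : forall v,
  u (d (d v)) = al *: d (u (d v)) + be *: d (d (u v)) + ga *: d v.

Local Notation free_UD := {malg k[{fmonom bool}]}.
Local Notation A := (downup al be ga).
Local Notation pi := (@downup_pi k al be ga).

(** The word b1 ... bn acts on the right, so its first letter acts first. *)
Definition letter_act (v : V) (b : bool) : V := if b then u v else d v.

Definition word_act : V -> seq bool -> V := foldl letter_act.

Definition free_act (v : V) (a : free_UD) : V :=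
  \sum_(m <- msupp a) a@_m *: word_act v m.

Definition downup_act (v : V) (x : A) : V := free_act v (repr x).

Lemma letter_act_linear b : linear (letter_act^~ b).
Proof. by case: b. Qed.

Lemma word_act_linear m : linear (word_act^~ m).
Proof.
elim: m => [|b m IHm] c v w //=; rewrite (letter_act_linear b); exact: IHm.
Qed.

Lemma free_actEw (dom : {fset {fmonom bool}}) v a : (msupp a `<=` dom)%fset ->
  free_act v a = \sum_(m <- dom) a@_m *: word_act v m.
Proof.
move=> le; rewrite /free_act (big_fset_incl _ le) // => m _ mNa.
by rewrite mcoeff_outdom ?scale0r.
Qed.

Lemma free_act_linear v : linear (free_act v).
Proof.
move=> c a b; pose dom := (msupp a `|` msupp b)%fset.
have le_a : (msupp a `<=` dom)%fset by exact: fsubsetUl.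
have le_b : (msupp b `<=` dom)%fset by exact: fsubsetUr.
have le_ab : (msupp (c *: a + b) `<=` dom)%fset.
  apply: fsubset_trans (msuppD_le _ _) _; apply: fsetSU; exact: msuppZ_le.
rewrite (free_actEw _ le_a) (free_actEw _ le_b) (free_actEw _ le_ab).
rewrite scaler_sumr -big_split /=; apply: eq_bigr => m _.
by rewrite mcoeffD mcoeffZ scalerDl scalerA.
Qed.

Lemma free_actU v c m : free_act v << c *g m >> = c *: word_act v m.
Proof. by rewrite (free_actEw _ msuppU_le) big_seq_fset1 mcoeffUU. Qed.

Lemma free_act_linearl a : linear (free_act^~ a).
Proof.
move=> c v w; rewrite /free_act scaler_sumr -big_split /=.
apply: eq_bigr => m _; rewrite (word_act_linear m) scalerDr !scalerA.
by rewrite mulrC.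
Qed.

Lemma free_act1 v : free_act v 1 = v.
Proof. by rewrite free_actU scale1r fm1. Qed.

Lemma free_actM v a b : free_act v (a * b) = free_act (free_act v a) b.
Proof.
rewrite malgME (linear_fun_sum (free_act_linear v)).
have -> : free_act (free_act v a) b =
    \sum_(m <- msupp a) free_act (a@_m *: word_act v m) b.
  exact: (linear_fun_sum (@free_act_linearl b)).
apply: eq_bigr => m _; rewrite (linear_fun_sum (free_act_linear v)).
rewrite [RHS](linear_funZ (@free_act_linearl b)) [in RHS]/free_act scaler_sumr.
apply: eq_bigr => n _.
by rewrite free_actU fmM /word_act foldl_cat scalerA.
Qed.

Lemma act_relator (B : lalgType k) (act : V -> B -> V) (x y : B) b v :
    (forall w, linear (act w)) ->
    (forall w p q, act w (p * q) = act (act w p) q) ->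
    (forall w, act w x = u w) -> (forall w, act w y = d w) ->
  act v (downup_relator al be ga x y b) = 0.
Proof.
move=> lin actM actU actD.
case: b; rewrite (linear_fun_comb (lin v)) expr2 !actM !actU !actD.
  by rewrite act_DUU subrr.
by rewrite act_DDU subrr.
Qed.

Lemma free_act_relator b v :
  free_act v (downup_relator al be ga (freeU k) (freeD k) b) = 0.
Proof.
apply: act_relator => [w|w p q|w|w]; first exact: free_act_linear.
- exact: free_actM.
- by rewrite free_actU scale1r fmU.
- by rewrite free_actU scale1r fmU.
Qed.

(** The action kills the two-sided ideal of relations, so the choice of a
    representative is immaterial. *)
Lemma downup_act_pi v a : downup_act v (pi a) = free_act v a.
Proof.
apply/eqP; rewrite -subr_eq0 -(linear_funB (free_act_linear v)).
have /gen_idealP[s ->] : repr (pi a) - a \in downup_ideal al be ga.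
  by apply/downup_piP; rewrite reprK.
rewrite (linear_fun_sum (free_act_linear v)) big1 // => t _.
by rewrite !free_actM free_act_relator (linear_fun0 (@free_act_linearl _)).
Qed.

Lemma downup_act_linear v : linear (downup_act v).
Proof.
move=> c x y; have [a ->] := downup_pi_surj x; have [b ->] := downup_pi_surj y.
by rewrite -!/(pi _) -linearP !downup_act_pi (free_act_linear v).
Qed.

Lemma downup_act_linearl x : linear (downup_act^~ x).
Proof. exact: free_act_linearl. Qed.

Lemma downup_act1 v : downup_act v 1 = v.
Proof. by rewrite -(rmorph1 pi) downup_act_pi free_act1. Qed.

Lemma downup_actM v x y : downup_act v (x * y) = downup_act (downup_act v x) y.
Proof.
have [a ->] := downup_pi_surj x; have [b ->] := downup_pi_surj y.
by rewrite -!/(pi _) -rmorphM !downup_act_pi free_actM.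
Qed.

Lemma downup_actU v : downup_act v (downupU al be ga) = u v.
Proof. by rewrite downup_act_pi free_actU scale1r fmU. Qed.

Lemma downup_actD v : downup_act v (downupD al be ga) = d v.
Proof. by rewrite downup_act_pi free_actU scale1r fmU. Qed.

End RightRepresentation.

Lemma monalgUZ (K : choiceType) (R : nzRingType) (c : R) (m : K) :
  << c *g m >> = c *: << m >> :> {malg R[K]}.
Proof. by apply/malgP => n; rewrite mcoeffZ !mcoeffU mulrnAr mulr1. Qed.

Section DownUpInd.
Variables (k : fieldType) (al be ga : k).
Local Notation A := (downup al be ga).
Local Notation U := (downupU al be ga).
Local Notation D := (downupD al be ga).

(** Words span the algebra, and each is built by right multiplications. *)
Lemma downup_ind (Q : A -> Prop) :
    Q 1 -> (forall c x y, Q x -> Q y -> Q (c *: x + y)) ->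
    (forall x, Q x -> Q (x * U)) -> (forall x, Q x -> Q (x * D)) ->
  forall x, Q x.
Proof.
move=> Q1 QL QU QD x.
have Q0 : Q 0 by rewrite -(subrr 1) -scaleN1r addrC; apply: QL.
have QM (s : seq bool) (m : {fmonom bool}) :
    m = s :> seq bool -> Q (downup_pi al be ga << m >>).
  elim/last_ind: s m => [|s b IHs] m ms.
    suff -> : m = mone by rewrite (rmorph1 (downup_pi al be ga)).
    by apply: val_inj; rewrite /= fm1.
  have -> : m = mmul (FMonom s) (fmu b).
    by apply: val_inj; rewrite /= ms fmM fmU /= cats1.
  have -> : << mmul (FMonom s) (fmu b) >> =
      << FMonom s >> * << fmu b >> :> {malg k[{fmonom bool}]}.
    by rewrite malgME !msuppU1 !big_seq_fset1 !mcoeffUU mulr1.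
  rewrite rmorphM; case: b ms => ms; [apply: QU|apply: QD]; exact: IHs.
have [a ->] := downup_pi_surj x; rewrite -/(downup_pi al be ga a).
rewrite (monalgE a) linear_sum; elim: (enum_fset _) => [|m s IHs].
  by rewrite big_nil.
by rewrite big_cons monalgUZ linearZ; apply: QL => //; apply: QM.
Qed.

End DownUpInd.

(** * The grading by deg U = 1 and deg D = -1 *)

Section MultipliedRelations.
Variables (k : fieldType) (al be ga : k) (B : algType k) (x u d : B).

Lemma mulr_relDUU :
    d * u ^+ 2 = al *: (u * d * u) + be *: (u ^+ 2 * d) + ga *: u ->
  x * d * u * u =
    al *: (x * u * d * u) + be *: (x * u * u * d) + ga *: (x * u).
Proof.
by move=> rel; rewrite -!mulrA -expr2 rel !mulrDr -!scalerAr expr2 !mulrA.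
Qed.

Lemma mulr_relDDU :
    d ^+ 2 * u = al *: (d * u * d) + be *: (u * d ^+ 2) + ga *: d ->
  x * d * d * u =
    al *: (x * d * u * d) + be *: (x * u * d * d) + ga *: (x * d).
Proof.
move=> rel; rewrite -[x * d * d]mulrA -expr2 -mulrA rel !mulrDr -!scalerAr.
by rewrite expr2 !mulrA.
Qed.

End MultipliedRelations.

Section Grading.
Variables (k : fieldType) (al be ga : k).
Local Notation A := (downup al be ga).
Local Notation U := (downupU al be ga).
Local Notation D := (downupD al be ga).

(** A sequence f stands for the formal sum of the f(n) t^n with coefficients in
    the algebra A; shiftU and shiftD are right multiplication by U t and D t^-1.
    The relations being homogeneous, this is a right representation, and letting
    a act on the constant 1 splits a into its homogeneous components. *)
Definition shiftU (f : int -> A) : int -> A := fun n => f (n - 1) * U.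
Definition shiftD (f : int -> A) : int -> A := fun n => f (n + 1) * D.
Definition delta0 : int -> A := fun n => if n == 0 then 1 else 0.

Lemma shiftU_linear : linear shiftU.
Proof.
by move=> c f g; apply/funext=> n; rewrite /shiftU !fctE mulrDl scalerAl.
Qed.

Lemma shiftD_linear : linear shiftD.
Proof.
by move=> c f g; apply/funext=> n; rewrite /shiftD !fctE mulrDl scalerAl.
Qed.

Lemma shift_DUU f : shiftU (shiftU (shiftD f)) =
  al *: shiftU (shiftD (shiftU f)) + be *: shiftD (shiftU (shiftU f))
  + ga *: shiftU f.
Proof.
apply/funext=> n; rewrite !fctE /shiftU /shiftD !(subrK, addrK).
exact: mulr_relDUU (downup_relDUU al be ga).
Qed.

Lemma shift_DDU f : shiftU (shiftD (shiftD f)) =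
  al *: shiftD (shiftU (shiftD f)) + be *: shiftD (shiftD (shiftU f))
  + ga *: shiftD f.
Proof.
apply/funext=> n; rewrite !fctE /shiftU /shiftD !(subrK, addrK).
exact: mulr_relDDU (downup_relDDU al be ga).
Qed.

Definition hcomp (n : int) (a : A) : A :=
  downup_act shiftU shiftD delta0 a n.

Lemma hcomp_linear n : linear (hcomp n).
Proof.
move=> c a b; rewrite /hcomp.
by rewrite (downup_act_linear shiftU_linear shiftD_linear shift_DUU shift_DDU).
Qed.
HB.instance Definition _ n :=
  GRing.isLinear.Build k A A *:%R (hcomp n) (hcomp_linear n).

Lemma hcomp1 n : hcomp n 1 = if n == 0 then 1 else 0.
Proof.
by rewrite /hcomp (downup_act1 shiftU_linear shiftD_linear shift_DUU shift_DDU).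
Qed.

Lemma hcompMU n a : hcomp n (a * U) = hcomp (n - 1) a * U.
Proof.
rewrite /hcomp (downup_actM shiftU_linear shiftD_linear shift_DUU shift_DDU).
by rewrite (downup_actU shiftU_linear shiftD_linear shift_DUU shift_DDU).
Qed.

Lemma hcompMD n a : hcomp n (a * D) = hcomp (n + 1) a * D.
Proof.
rewrite /hcomp (downup_actM shiftU_linear shiftD_linear shift_DUU shift_DDU).
by rewrite (downup_actD shiftU_linear shiftD_linear shift_DUU shift_DDU).
Qed.

Definition homog (n : int) (a : A) : Prop :=
  forall m, hcomp m a = if m == n then a else 0.

Lemma homog1 : homog 0 1.
Proof. exact: hcomp1. Qed.

Lemma homog_comb n c a b : homog n a -> homog n b -> homog n (c *: a + b).
Proof.
by move=> ha hb m; rewrite linearP /= ha hb; case: eqP; rewrite ?scaler0 ?addr0.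
Qed.

Lemma homogMU n a : homog n a -> homog (n + 1) (a * U).
Proof.
by move=> ha m; rewrite hcompMU ha subr_eq; case: eqP; rewrite ?mul0r.
Qed.

Lemma homogMD n a : homog n a -> homog (n - 1) (a * D).
Proof.
move=> ha m; rewrite hcompMD ha -[m == n - 1](inj_eq (addIr 1)) subrK.
by case: eqP; rewrite ?mul0r.
Qed.

Lemma homogU : homog 1 U.
Proof. by rewrite -[U]mul1r; have := homogMU homog1; rewrite add0r. Qed.

Lemma homogD : homog (-1) D.
Proof. by rewrite -[D]mul1r; have := homogMD homog1; rewrite add0r. Qed.

(** Left multiplication by a homogeneous element commutes with the right action
    that defines the components, up to a shift of degrees. *)
Lemma hcompM_homog n a m b : homog n a -> hcomp m (a * b) = a * hcomp (m - n) b.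
Proof.
move=> ha; elim/downup_ind: b m => [m|c x y IHx IHy m|x IHx m|x IHx m].
- by rewrite mulr1 ha hcomp1 subr_eq0; case: eqP; rewrite ?mulr1 ?mulr0.
- by rewrite mulrDr -scalerAr !linearP /= IHx IHy mulrDr -scalerAr.
- by rewrite mulrA hcompMU IHx hcompMU mulrA addrAC.
- by rewrite mulrA hcompMD IHx hcompMD mulrA addrAC.
Qed.

Lemma homogM n a m b : homog n a -> homog m b -> homog (n + m) (a * b).
Proof.
move=> ha hb l; rewrite (hcompM_homog _ _ ha) hb subr_eq addrC.
by case: eqP; rewrite ?mulr0.
Qed.

Lemma homog_sum_exists a : exists s : seq (int * A),
  (forall t, t \in s -> homog t.1 t.2) /\ a = \sum_(t <- s) t.2.
Proof.
elim/downup_ind: a => [|c x y [s [hs ->]] [s' [hs' ->]]|x [s [hs ->]]|x [s [hs ->]]].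
- exists [:: (0, 1)]; split; last by rewrite big_seq1.
  by move=> t; rewrite inE => /eqP->; exact: homog1.
- exists ([seq (t.1, c *: t.2) | t <- s] ++ s'); split; last first.
    by rewrite big_cat big_map scaler_sumr.
  move=> t; rewrite mem_cat => /orP[/mapP[t0 /hs ht0 ->]|/hs' //].
  rewrite -[(_, _).2]addr0; apply: homog_comb => // m.
  by rewrite linear0; case: ifP.
- exists [seq (t.1 + 1, t.2 * U) | t <- s]; split; last first.
    by rewrite big_map mulr_suml.
  by move=> t /mapP[t0 /hs ht0 ->]; exact: homogMU.
- exists [seq (t.1 - 1, t.2 * D) | t <- s]; split; last first.
    by rewrite big_map mulr_suml.
  by move=> t /mapP[t0 /hs ht0 ->]; exact: homogMD.
Qed.

Lemma homog_hcomp n a : homog n (hcomp n a).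
Proof.
move=> m; have [s [hs ->]] := homog_sum_exists a.
rewrite !linear_sum /=.
transitivity (\sum_(t <- s | t \in s) hcomp m (hcomp n t.2)).
  by rewrite -big_seq.
transitivity (\sum_(t <- s | t \in s) if m == n then hcomp n t.2 else 0); last first.
  by rewrite -big_seq; case: eqP => // _; rewrite big1.
apply: eq_bigr => t /hs ht; rewrite ht; have [e|_] := eqVneq n t.1.
  by rewrite ht e.
by rewrite linear0; case: ifP.
Qed.

(** The index list depends on a, but it is duplicate-free and contains the whole
    support, so that sums over it can be compared degree by degree. *)
Lemma hcomp_decomp a : exists s : seq int,
  [/\ uniq s, forall n, n \notin s -> hcomp n a = 0
    & a = \sum_(n <- s) hcomp n a].
Proof.
have [s [hs ->]] := homog_sum_exists a.
exists (undup [seq t.1 | t <- s]); split; first exact: undup_uniq.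
  move=> n; rewrite mem_undup => nNs; rewrite linear_sum big_seq big1 //= => t ts.
  by rewrite (hs _ ts); case: eqP => // e; rewrite e map_f in nNs.
under [RHS]eq_bigr do rewrite linear_sum.
rewrite exchange_big /= big_seq [RHS]big_seq; apply: eq_bigr => t ts.
rewrite (bigD1_seq t.1) ?undup_uniq ?mem_undup ?map_f //= hs // eqxx.
by rewrite big1 ?addr0 // => n /negPf ne; rewrite hs // ne.
Qed.

Lemma hcomp_inj a : (forall n, hcomp n a = 0) -> a = 0.
Proof.
by have [s [_ _ {2}->]] := hcomp_decomp a => a0; rewrite big1.
Qed.

(** If U b = b, each component of b is U times the preceding one; as b has no
    component in low degrees, all of them vanish. *)
Lemma lreg_U_sub1 b : (U - 1) * b = 0 -> b = 0.
Proof.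
move=> /eqP; rewrite mulrBl mul1r subr_eq0 => /eqP Ub.
have shift n : hcomp n b = U * hcomp (n - 1) b.
  by rewrite -{1}Ub (hcompM_homog _ _ homogU).
have [s [s_uniq supp _]] := hcomp_decomp b.
have supp_low i n : hcomp n b = 0 -> hcomp (n + i%:Z) b = 0.
  by elim: i => [|i IHi] b0; rewrite ?addr0 // shift intS addrCA addrC addrK IHi ?mulr0.
pose N := (\sum_(n <- s) absz n)%N.
have low n : n \in s -> - N%:Z <= n.
  by move=> ns; have : (absz n <= N)%N; [rewrite /N (bigD1_seq n) //= leq_addr | lia].
apply: hcomp_inj => n.
have [nN|Nn] := ltP n (- N%:Z).
  by apply: supp; apply/negP => /low; rewrite leNgt nN.
have -> : n = - N.+1%:Z + (absz (n + N.+1%:Z))%:Z by lia.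
by apply/supp_low/supp/negP => /low; rewrite lerN2 lez_nat ltnn.
Qed.

End Grading.

(** * The element W *)

Section WElement.
Variables (k : fieldType) (al be ga r s : k).
Hypotheses (al_rs : al = r + s) (be_rs : be = - (r * s)).
Local Notation A := (downup al be ga).
Local Notation U := (downupU al be ga).
Local Notation D := (downupD al be ga).

(** With r and s the roots of t^2 - alpha t - beta, this element makes W and U
    generate a skew polynomial algebra: moving U across W turns W into
    s W + gamma. *)
Definition downupW : A := D * U - r *: (U * D).
Local Notation W := downupW.
Local Notation W' := (s *: W + ga%:A).

Lemma downup_WU : W * U = U * W'.
Proof.
rewrite /downupW mulrBl -scalerAl -[D * U * U]mulrA -expr2 downup_relDUU.
rewrite mulrDr -scalerAr mulrBr -scalerAr [U * ga%:A]mulr_algr !mulrA expr2.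
rewrite scalerBr scalerA al_rs be_rs scalerDl scaleNr mulrC.
rewrite addrAC; congr (_ + _).
rewrite -!addrA addrC -!addrA; congr (_ + _).
by rewrite addrA subrK.
Qed.

Lemma homogW : homog 0 W.
Proof.
have hDU : homog 0 (D * U) by exact: (homogM (homogD _ _ _) (homogU _ _ _)).
have hUD : homog 0 (U * D) by exact: (homogM (homogU _ _ _) (homogD _ _ _)).
by rewrite /downupW addrC -scaleNr; exact: homog_comb.
Qed.

End WElement.

(** * Coefficients in a skew Laurent ring *)

Lemma seq_maximizer (I : eqType) (F : I -> int) (s : seq I) i0 : i0 \in s ->
  exists2 i, i \in s & forall j, j \in s -> F j <= F i.
Proof.
elim: s i0 => // j s IHs i0 _; case: s IHs => [_|i1 s IHs].
  by exists j; rewrite ?mem_head // => i; rewrite inE => /eqP->.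
have [i is_ max_i] := IHs i1 (mem_head _ _).
have [le_ij|lt_ji] := leP (F i) (F j).
  exists j; first exact: mem_head.
  by move=> l; rewrite inE => /orP[/eqP-> //|/max_i/le_trans->].
exists i; first by rewrite inE is_ orbT.
by move=> l; rewrite inE => /orP[/eqP->|/max_i //]; exact: ltW.
Qed.

(** The skew Laurent ring P[U, U^-1; sig] is used through its right module P,
    its quotient by the right ideal generated by U - 1: there U acts as sig and
    D = U^-1 h acts as p |-> tau(p) h, with tau the inverse of sig.  On the
    component of degree n of a the action is p |-> sig^n(p) c with c in P, and c
    is the coefficient of U^n in the image of a. *)
Section SkewRepresentation.
Variables (k : fieldType) (al be ga : k).
Variables (P : comUnitAlgType k) (sig tau : {lrmorphism P -> P}) (h : P).
Hypothesis P_domain : forall p q : P, p * q = 0 -> p = 0 \/ q = 0.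
Hypotheses (sigK : cancel sig tau) (tauK : cancel tau sig).
Hypothesis sig_h : sig (sig h) = al *: sig h + be *: h + ga%:A.
Local Notation A := (downup al be ga).
Local Notation U := (downupU al be ga).
Local Notation D := (downupD al be ga).

Definition skewD (p : P) : P := tau p * h.

Lemma sig_linear : linear sig.
Proof. by move=> c p q; rewrite linearP. Qed.

Lemma skewD_linear : linear skewD.
Proof. by move=> c p q; rewrite /skewD linearP mulrDl scalerAl. Qed.

Lemma skew_DUU p : sig (sig (skewD p)) =
  al *: sig (skewD (sig p)) + be *: skewD (sig (sig p)) + ga *: sig p.
Proof.
rewrite /skewD !rmorphM /= tauK !sigK sig_h !mulrDr -!scalerAr.
by rewrite mulr1.
Qed.

Lemma skew_DDU p : sig (skewD (skewD p)) =
  al *: skewD (sig (skewD p)) + be *: skewD (skewD (sig p)) + ga *: skewD p.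
Proof.
rewrite /skewD !rmorphM /= !tauK !sigK.
have -> : sig h = al *: h + be *: tau h + ga%:A.
  by rewrite -[sig h]sigK sig_h !linearD !linearZ /= sigK rmorph1.
rewrite !mulrDr -!scalerAr !mulr1.
by rewrite [tau p * tau h * h]mulrAC.
Qed.

Definition skew_act : P -> A -> P := downup_act sig skewD.

Lemma skew_act_linear p : linear (skew_act p).
Proof. exact: (downup_act_linear sig_linear skewD_linear skew_DUU skew_DDU). Qed.
HB.instance Definition _ p :=
  GRing.isLinear.Build k A P *:%R (skew_act p) (skew_act_linear p).

Lemma skew_act_linearl a : linear (skew_act^~ a).
Proof. exact: (downup_act_linearl sig_linear skewD_linear). Qed.

Lemma skew_act1 p : skew_act p 1 = p.
Proof. exact: (downup_act1 sig_linear skewD_linear skew_DUU skew_DDU). Qed.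

Lemma skew_actM p a b : skew_act p (a * b) = skew_act (skew_act p a) b.
Proof. exact: (downup_actM sig_linear skewD_linear skew_DUU skew_DDU). Qed.

Lemma skew_actU p : skew_act p U = sig p.
Proof. exact: (downup_actU sig_linear skewD_linear skew_DUU skew_DDU). Qed.

Lemma skew_actD p : skew_act p D = tau p * h.
Proof. exact: (downup_actD sig_linear skewD_linear skew_DUU skew_DDU). Qed.

Definition sig_pow (n : int) (p : P) : P :=
  match n with Posz m => iter m sig p | Negz m => iter m.+1 tau p end.

Lemma sig_powS n p : sig_pow (n + 1) p = sig (sig_pow n p).
Proof.
case: n => [n|[|n]]; first by rewrite addrC -intS.
  by rewrite NegzE addNr /= tauK.
by rewrite NegzE intS opprD addrC addNKr -NegzE /= tauK.
Qed.

Lemma sig_powB1 n p : sig_pow (n - 1) p = tau (sig_pow n p).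
Proof. by rewrite -{2}[n](subrK 1) sig_powS sigK. Qed.

Lemma sig_pow_ind (Q : P -> Prop) n p : Q p ->
  (forall q, Q q -> Q (sig q)) -> (forall q, Q q -> Q (tau q)) -> Q (sig_pow n p).
Proof.
move=> Qp Qs Qt; case: n => n /=; first by elim: n => //= n; exact: Qs.
by apply: (Qt); elim: n => //= n; exact: Qt.
Qed.

Lemma sig_pow_sig n p : sig_pow n (sig p) = sig (sig_pow n p).
Proof.
case: n => n; first by rewrite /= -iterSr.
by elim: n => [|n IHn]; rewrite /= ?sigK ?tauK //; move: IHn => /= ->; rewrite sigK.
Qed.

Lemma sig_pow_linear n : linear (sig_pow n).
Proof.
move=> c p q; have iter_linear (f : {lrmorphism P -> P}) i :
    iter i f (c *: p + q) = c *: iter i f p + iter i f q.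
  by elim: i => //= i ->; rewrite linearP.
by case: n => n; exact: iter_linear.
Qed.

Lemma sig_pow_alg n c : sig_pow n c%:A = c%:A.
Proof.
by apply: (@sig_pow_ind (fun q => q = c%:A)) => // q ->; rewrite linearZ /= rmorph1.
Qed.

Lemma sig_pow0 n : sig_pow n 0 = 0.
Proof. by apply: (@sig_pow_ind (fun q => q = 0)) => // q ->; rewrite rmorph0. Qed.

Lemma sig_pow_neq0 n p : p != 0 -> sig_pow n p != 0.
Proof.
move=> p0; apply: (@sig_pow_ind (fun q => q != 0)) => // q.
  by apply: contraNneq => e; rewrite -[q]sigK e rmorph0.
by apply: contraNneq => e; rewrite -[q]tauK e rmorph0.
Qed.

Lemma sig_pow_nunit n p :
  p \isn't a GRing.unit -> sig_pow n p \isn't a GRing.unit.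
Proof.
move=> pN; apply: (@sig_pow_ind (fun q => q \isn't a GRing.unit)) => // q.
  by apply: contra => /(rmorph_unit tau); rewrite /= sigK.
by apply: contra => /(rmorph_unit sig); rewrite /= tauK.
Qed.

Lemma sig_pow_unit n p : sig_pow n p \is a GRing.unit -> p \is a GRing.unit.
Proof. exact: contraLR (@sig_pow_nunit n p). Qed.

(** The coefficient of U^n, written to the right of U^n, in the image of a. *)
Definition symbol (n : int) (a : A) : P := skew_act 1 (hcomp n a).

Lemma skew_act_hcomp p n a : skew_act p (hcomp n a) = sig_pow n p * symbol n a.
Proof.
rewrite /symbol; elim/downup_ind: a n => [n|c x y IHx IHy n|x IHx n|x IHx n].
- rewrite !hcomp1; case: eqP => [->|_]; last by rewrite !linear0 mulr0.
  by rewrite !skew_act1 mulr1.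
- by rewrite !linearP /= IHx IHy mulrDr scalerAr.
- by rewrite !hcompMU !skew_actM !skew_actU IHx rmorphM /= -sig_powS subrK.
- by rewrite !hcompMD !skew_actM !skew_actD IHx rmorphM /= -sig_powB1 addrK mulrA.
Qed.

Lemma skew_act_sum p s a : a = \sum_(n <- s) hcomp n a ->
  skew_act p a = \sum_(n <- s) sig_pow n p * symbol n a.
Proof.
move=> {1}->; rewrite linear_sum.
by apply: eq_bigr => n _; exact: skew_act_hcomp.
Qed.

(** The product of the skew Laurent ring: 
    (U^i p) (U^j q) = U^(i+j) sig^j(p) q. *)
Lemma symbolM s n a b : a = \sum_(i <- s) hcomp i a ->
  symbol n (a * b) = \sum_(i <- s) sig_pow (n - i) (symbol i a) * symbol (n - i) b.
Proof.
move=> {1}->; rewrite mulr_suml /symbol !linear_sum; apply: eq_bigr => i _ /=.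
by rewrite (hcompM_homog _ _ (homog_hcomp i a)) skew_actM skew_act_hcomp.
Qed.

Lemma symbolM_neq0 n a b : symbol n (a * b) != 0 ->
  (exists i, symbol i a != 0) /\ (exists i, symbol i b != 0).
Proof.
have [s [_ _ a_sum]] := hcomp_decomp a; rewrite (symbolM _ _ a_sum) => ab.
have [i i0] : exists i, sig_pow (n - i) (symbol i a) * symbol (n - i) b != 0.
  apply/not_existsP => z; move/eqP: ab; apply.
  by rewrite big1 // => i _; apply/eqP/negPn/negP/z.
split; [exists i|exists (n - i)]; apply: contraNneq i0 => ->.
  by rewrite sig_pow0 mul0r.
by rewrite mulr0.
Qed.

(** For e = 1 this is the highest degree of the support, for e = -1 the lowest;
    the sign e treats both at once. *)
Definition extremal (e : int) (a : A) (n : int) : Prop :=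
  symbol n a != 0 /\ forall i, e * n < e * i -> symbol i a = 0.

Lemma extremal_exists e a : (exists i, symbol i a != 0) -> exists n, extremal e a n.
Proof.
have [s [_ supp _]] := hcomp_decomp a => -[i i0].
have in_s j : symbol j a != 0 -> j \in s.
  by apply: contraR => /supp aj; rewrite /symbol aj linear0.
pose s' := [seq j <- s | symbol j a != 0].
have i_s' : i \in s' by rewrite mem_filter i0 in_s.
have [n + max_n] := seq_maximizer (fun j => e * j) i_s'.
rewrite mem_filter => /andP[n0 _]; exists n; split=> // j; apply: contraTeq => j0.
by rewrite -leNgt max_n // mem_filter j0 in_s.
Qed.

(** P is a domain and sig is injective, so extremal coefficients do not
    cancel. *)
Lemma extremalM e a b n m : e != 0 -> extremal e a n -> extremal e b m ->
  extremal e (a * b) (n + m) /\ symbol (n + m) (a * b) = sig_pow m (symbol n a) * symbol m b.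
Proof.
move=> e0 [an0 an] [bm0 bm].
have [s [s_uniq supp a_sum]] := hcomp_decomp a.
have n_s : n \in s by apply: contraR an0 => /supp an'; rewrite /symbol an' linear0.
have lead : symbol (n + m) (a * b) = sig_pow m (symbol n a) * symbol m b.
  rewrite (symbolM _ _ a_sum) (bigD1_seq n) //= addrAC subrr add0r big1 ?addr0 //.
  move=> i ne_in; have [lt_ni|] := ltP (e * n) (e * i).
    by rewrite an // sig_pow0 mul0r.
  rewrite le_eqVlt (inj_eq (mulfI e0)) (negPf ne_in) /= => lt_in.
  by rewrite (bm (n + m - i)) ?mulr0 // !mulrDr mulrN addrAC ltrDr subr_gt0.
split=> //; split=> [|l lt_l].
  rewrite lead; apply/eqP => /P_domain[] /eqP; apply/negP => //.
  exact: sig_pow_neq0.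
rewrite (symbolM _ _ a_sum) big1 // => i _.
have [lt_ni|le_in] := ltP (e * n) (e * i).
  by rewrite an // sig_pow0 mul0r.
rewrite (bm (l - i)) ?mulr0 //; move: lt_l le_in; rewrite !mulrDr mulrN.
by lia.
Qed.

Lemma extremal_uniq e a n m : e != 0 -> extremal e a n -> extremal e a m -> n = m.
Proof.
move=> e0 [an0 an] [am0 am]; apply: (mulfI e0); apply: le_anti.
by rewrite !leNgt (contra_neqN (an m)) // (contra_neqN (am n)).
Qed.

Variables (r s : k).
Hypotheses (al_rs : al = r + s) (be_rs : be = - (r * s)).
Hypothesis ga_neq0 : ga != 0.
Let w : P := sig h - r *: h.
Hypothesis w_nunit : w \isn't a GRing.unit.

Local Notation W := (downupW al be ga r).
Local Notation W' := (s *: W + ga%:A).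

Lemma sig_w : sig w = s *: w + ga%:A.
Proof.
rewrite /w linearB linearZ /= sig_h al_rs be_rs scalerBr scalerA scalerDl.
rewrite scaleNr [s * r]mulrC addrAC; congr (_ + _).
by rewrite addrAC; congr (_ - _); rewrite addrAC subrr add0r.
Qed.

Lemma w_neq0 : w != 0.
Proof.
apply: contra_neq ga_neq0 => w0; have := sig_w; rewrite w0 rmorph0 scaler0 add0r.
by move=> /esym/eqP; rewrite scaler_eq0 oner_eq0 orbF => /eqP.
Qed.

Lemma skew_actW p : skew_act p W = p * w.
Proof.
rewrite /downupW linearB linearZ /= !skew_actM // skew_actU // skew_actD //.
by rewrite skew_actU // skew_actD // rmorphM /= tauK sigK mulrBr scalerAr.
Qed.

(** Up to a scalar factor, the generators of the colon ideal that come from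
    projecting the standard basis of A^2 onto the kernel of (W, U - 1). *)
Definition colon_gen1 : A := U * W - W'.
Definition colon_gen2 : A := (U - s%:A) * (U - 1).

Lemma skew_act_algE p c : skew_act p c%:A = c *: p.
Proof. by rewrite linearZ /= skew_act1. Qed.

Lemma symbol_gen1 n : symbol n colon_gen1 =
  if n == 1 then w else if n == 0 then - sig w else 0.
Proof.
have hUW : homog 1 (U * W).
  by rewrite -[1%R]addr0; apply: homogM (homogU _ _ _) (homogW _ _ _ _).
have hW' : homog 0 W'.
  apply: (homog_comb s (homogW _ _ _ _)); rewrite -[ga%:A]addr0; apply: homog_comb.
    exact: homog1.
  by move=> m; rewrite linear0; case: ifP.
rewrite /symbol /colon_gen1 linearB /= hUW hW'.
have [->|n1] := eqVneq n 1.
  rewrite linearB /= linear0 subr0 skew_actM // skew_actU // rmorph1.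
  by rewrite skew_actW mul1r.
rewrite linearB linear0 sub0r; case: eqP => // _; last by rewrite linear0 oppr0.
by rewrite linearD linearZ /= skew_actW mul1r skew_act_algE sig_w.
Qed.

Lemma colon_gen2E : colon_gen2 = U * U - (s + 1) *: U + s%:A.
Proof.
rewrite /colon_gen2 mulrBr mulr1 mulrBl mulr_algl opprB addrA.
by rewrite scalerDl scale1r opprD addrA addrAC.
Qed.

Lemma symbol_gen2 n : symbol n colon_gen2 =
  if n == 2 then 1 else if n == 1 then - (s + 1)%:A
  else if n == 0 then s%:A else 0.
Proof.
have hUU : homog 2 (U * U) by exact: (homogM (homogU _ _ _) (homogU _ _ _)).
rewrite /symbol colon_gen2E linearD linearB !linearZ /= hUU (homogU _ _ _) hcomp1.
rewrite !linearD !linearZ linearN /=.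
have [->|n2] := eqVneq n 2.
  by rewrite skew_actM !skew_actU !rmorph1 !linear0 !addr0.
have [->|n1] := eqVneq n 1.
  by rewrite !linear0 skew_actU rmorph1 addr0 add0r.
rewrite !linear0 !add0r; case: eqP => _.
  by rewrite skew_act1.
by rewrite !linear0.
Qed.

(** W acts on 1 as w and U - 1 kills 1. *)
Lemma skew_act_colon g b : W * g = (U - 1) * b -> skew_act w g = 0.
Proof.
move=> gb; have -> : w = skew_act 1 W by rewrite skew_actW mul1r.
rewrite -skew_actM gb skew_actM linearB /= skew_actU skew_act1 rmorph1 subrr.
exact: (linear_fun0 (skew_act_linearl b)).
Qed.

(** Comparing extremal degrees in the two multiples of g shows that g has a unit
    as leading coefficient and at most two terms; then w g = 0 makes a conjugate
    of the nonunit w divide a unit. *)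
Lemma no_generator g b t1 t2 : W * g = (U - 1) * b ->
  colon_gen1 = g * t1 -> colon_gen2 = g * t2 -> False.
Proof.
move=> /skew_act_colon wg0 e1 e2.
have symbol10 : symbol 1 colon_gen1 != 0 by rewrite symbol_gen1 w_neq0.
have symbol20 : symbol 2 colon_gen2 != 0 by rewrite symbol_gen2 oner_eq0.
have ext1 : extremal 1 colon_gen1 1.
  split=> // i; rewrite !mul1r symbol_gen1 => lt1i.
  have /negPf-> : i != 1 by lia.
  by have /negPf-> : i != 0; [lia | by []].
have ext1' : extremal (-1) colon_gen1 0.
  split=> [|i]; rewrite symbol_gen1 /=.
    by rewrite oppr_eq0; apply: contra_neq w_neq0 => e; rewrite -[w]sigK e rmorph0.
  move=> lt1i; have /negPf-> : i != 1 by lia.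
  by have /negPf-> : i != 0; [lia | by []].
have ext2 : extremal 1 colon_gen2 2.
  split=> // i; rewrite !mul1r symbol_gen2 => lt2i.
  have /negPf-> : i != 2 by lia. have /negPf-> : i != 1 by lia.
  by have /negPf-> : i != 0; [lia | by []].
have [g_nz t1_nz] := symbolM_neq0 (eq_rect _ (fun x => symbol 1 x != 0) symbol10 _ e1).
have [_ t2_nz] := symbolM_neq0 (eq_rect _ (fun x => symbol 2 x != 0) symbol20 _ e2).
have [N gN] := extremal_exists 1 g_nz; have [n gn] := extremal_exists (-1) g_nz.
have [M tM] := extremal_exists 1 t1_nz; have [m tm] := extremal_exists (-1) t1_nz.
have [L tL] := extremal_exists 1 t2_nz.
have e_pos : (1 : int) != 0 by []; have e_neg : (-1 : int) != 0 by [].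
have NM : N + M = 1.
  apply: (extremal_uniq e_pos) ext1; rewrite e1; exact: (extremalM e_pos gN tM).1.
have nm : n + m = 0.
  apply: (extremal_uniq e_neg) ext1'; rewrite e1; exact: (extremalM e_neg gn tm).1.
have NL : N + L = 2.
  apply: (extremal_uniq e_pos) ext2; rewrite e2; exact: (extremalM e_pos gN tL).1.
(* The leading coefficient of colon_gen2 is 1. *)
have gN_unit : symbol N g \is a GRing.unit.
  apply: (@sig_pow_unit L); apply/unitrPr; exists (symbol L t2).
  by rewrite -(extremalM e_pos gN tL).2 -e2 NL symbol_gen2.
(* With NM and nm, this bounds the width N - n of g by 1. *)
have le_mM : m <= M.
  by rewrite leNgt; apply/negP => lt; move: tm.1; rewrite tM.2 ?eqxx ?mul1r.
have le_nN : n <= N.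
  by rewrite leNgt; apply/negP => lt; move: gn.1; rewrite gN.2 ?eqxx ?mul1r.
have [d [d_uniq supp g_sum]] := hcomp_decomp g.
have N_d : N \in d by apply: contraR gN.1 => /supp gN0; rewrite /symbol gN0 linear0.
(* Outside N and n the symbol of g vanishes, because N - n <= 1. *)
have off i : i != N -> i != n -> symbol i g = 0.
  move=> iN ni; have [lt|le] := ltP N i; first by rewrite gN.2 ?mul1r.
  by rewrite gn.2 // !mulN1r; lia.
move: wg0; rewrite (skew_act_sum _ g_sum) (bigD1_seq N) //=.
have [eNn|neq_Nn] := eqVneq N n.
  rewrite big1 ?addr0 => [/P_domain[]/eqP|i iN].
  - by apply/negP/sig_pow_neq0/w_neq0.
  - by apply/negP: gN.1.
  - by rewrite off ?mulr0 // -eNn.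
have eN : N = n + 1 by lia.
have n_d : n \in d by apply: contraR gn.1 => /supp gn0; rewrite /symbol gn0 linear0.
rewrite -big_filter (bigD1_seq n) ?filter_uniq ?mem_filter ?n_d 1?eq_sym ?neq_Nn //=.
rewrite big_filter_cond big1 ?addr0 => [|i /andP[iN ni]]; last by rewrite off ?mulr0.
rewrite {1}eN sig_powS -sig_pow_sig sig_w sig_pow_linear sig_pow_alg.
set v := sig_pow n w; set q := symbol N g; set p := symbol n g => rel.
suff : v \is a GRing.unit by apply/negP/sig_pow_nunit.
(* rel amounts to v (s q + p) = - gamma q. *)
apply/unitrPr; exists (- (s *: q + p) * (ga^-1 *: q^-1)).
have -> : v * (- (s *: q + p) * (ga^-1 *: q^-1)) =
    - (v * (s *: q + p)) * (ga^-1 *: q^-1) by rewrite mulrA mulrN.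
have -> : - (v * (s *: q + p)) = ga *: q.
  apply/eqP; rewrite eq_sym -subr_eq0 opprK -rel mulrDr mulrDl -scalerAr.
  by rewrite -!scalerAl mul1r addrA [ga *: q + _]addrC.
by rewrite -scalerAl -scalerAr scalerA mulfV // scale1r divrr.
Qed.

End SkewRepresentation.

(** * The right ideal attached to a unimodular row of length two *)

Section ColonIdeal.
Variables (S : nzRingType) (x y : S).

Definition in_colon (a : S) : Prop := exists b : S, x * a = y * b.

Definition colon : {pred (S^c)^o} := fun a => `[< in_colon a >].

Lemma colonP (a : S) : reflect (in_colon a) ((a : (S^c)^o) \in colon).
Proof. exact: asboolP. Qed.

Lemma in_colon_comb (a a' b b' c : S) :
  x * a = y * b -> x * a' = y * b' -> x * (a * c + a') = y * (b * c + b').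
Proof. by move=> eb eb'; rewrite !mulrDr !mulrA eb eb'. Qed.

Lemma colon_submod_closed : submod_closed colon.
Proof.
split=> [|c a a' /colonP[b eb] /colonP[b' eb']].
  by apply/colonP; exists 0; rewrite !mulr0.
by apply/colonP; exists (b * (c : S) + b'); exact: in_colon_comb.
Qed.
HB.instance Definition _ :=
  GRing.isSubmodClosed.Build S^c (S^c)^o colon colon_submod_closed.

Definition colon_ideal : right_ideal S := colon.

Variables (p q : S).
Hypothesis xpyq : x * p + y * q = 1.

Local Notation I := (submodule colon_ideal).

Lemma colon_val (l : I) : in_colon (val l).
Proof. by apply/colonP; exact: valP. Qed.

Definition quot_by (l : I) : S := projT1 (cid (colon_val l)).

Lemma quot_byP (l : I) : x * (val l : S) = y * quot_by l.
Proof. exact: projT2 (cid (colon_val l)). Qed.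

Lemma val_comb (c : S^c) (l l' : I) :
  (val (c *: l + l') : S) = (val l : S) * (c : S) + val l'.
Proof. by rewrite GRing.valD GRing.valZ; reflexivity. Qed.

(** The next two elements are the first coordinates of the projections of (1, 0)
    and (0, 1) onto the kernel of (x, y), along (p, q). *)
Lemma in_colon_complement : in_colon (1 - p * x).
Proof.
exists (q * x); rewrite mulrBr mulr1 !mulrA -{1}[x]mul1r -mulrBl -xpyq.
by rewrite addrAC subrr add0r.
Qed.

Lemma in_colon_mulr : in_colon (p * y).
Proof.
exists (1 - q * y); rewrite mulrBr mulr1 !mulrA -{2}[y]mul1r -mulrBl -xpyq.
by rewrite addrK.
Qed.

Section StablyFree.
Hypothesis y_lreg : forall b, y * b = 0 -> b = 0.

Lemma quot_by_uniq (l : I) b : x * (val l : S) = y * b -> quot_by l = b.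
Proof.
rewrite quot_byP => /eqP; rewrite -subr_eq0 -mulrBr => /eqP /y_lreg /eqP.
by rewrite subr_eq0 => /eqP.
Qed.

(** The isomorphism I + S = S^2 sends (l, z) to (l, - b) + (p, q) z, where b is
    the quotient with x l = y b, so that (l, - b) lies in the kernel of (x, y). *)
Definition split_entry (l : I) (z : S) (j : 'I_2) : S :=
  if j == 0 then (val l : S) + p * z else - quot_by l + q * z.

Lemma split_entry_comb (l l1 l2 : I) (z z1 z2 c : S) j :
    (val l : S) = (val l1 : S) * c + val l2 -> z = z1 * c + z2 ->
  split_entry l z j = split_entry l1 z1 j * c + split_entry l2 z2 j.
Proof.
move=> el ->; rewrite /split_entry.
have -> : quot_by l = quot_by l1 * c + quot_by l2.
  by apply: quot_by_uniq; rewrite el; apply: in_colon_comb; exact: quot_byP.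
case: ifP => _; rewrite ?el mulrDl mulrDr !mulrA; first by rewrite addrACA.
by rewrite opprD -mulNr addrACA.
Qed.

Definition split_row (v : I * 'rV[S^c]_1) : 'rV[S^c]_2 :=
  \row_(j < 2) split_entry v.1 (v.2 0 0) j.

Lemma split_row_linear : linear split_row.
Proof.
move=> c v w; apply/rowP => j; rewrite !mxE.
have e1 := val_comb c v.1 w.1.
exact: (@split_entry_comb _ _ _ _ (v.2 0 0) (w.2 0 0) _ j e1 erefl).
Qed.
HB.instance Definition _ := GRing.isLinear.Build S^c (I * 'rV[S^c]_1)%type
  'rV[S^c]_2 *:%R split_row split_row_linear.

Lemma split_rowK_kernel (a b : S) (z := x * a + y * b) :
  x * (a - p * z) = y * (q * z - b).
Proof.
apply/eqP; rewrite -subr_eq0 !mulrBr opprB addrACA -/z !mulrA.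
by rewrite -opprD -mulrDl xpyq mul1r subrr.
Qed.

Lemma split_rowK_cokernel (l m z : S) : x * l = y * m ->
  x * (l + p * z) + y * (- m + q * z) = z.
Proof.
move=> lm; rewrite !mulrDr mulrN -lm addrACA addrN add0r !mulrA.
by rewrite -mulrDl xpyq mul1r.
Qed.

Lemma split_row_bij : bijective split_row.
Proof.
pose z (r : 'rV[S^c]_2) : S := x * (r 0 0 : S) + y * (r 0 1 : S).
have lI (r : 'rV[S^c]_2) :
    ((r 0 0 : S) - p * z r : (S^c)^o) \in colon_ideal.
  by apply/colonP; exists (q * z r - r 0 1); exact: split_rowK_kernel.
exists (fun r => (Submodule (lI r), \row_(j < 1) z r)).
  case=> l r; have zE : z (split_row (l, r)) = r 0 0.
    by rewrite /z !mxE; apply: split_rowK_cokernel; exact: quot_byP.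
  congr (_, _); last by apply/rowP => j; rewrite mxE zE ord1.
  apply: val_inj; rewrite [LHS]/= zE mxE; exact: addrK.
move=> r; apply/rowP => j; rewrite mxE [(_, _).1]/= [(_, _).2]/= mxE.
have [->|->] : j = 0 \/ j = 1.
  by case: j => [[|[|//]] ?]; [left|right]; apply: val_inj.
  exact: subrK.
rewrite /split_entry /= (@quot_by_uniq _ (q * z r - r 0 1)).
  by rewrite opprB subrK.
exact: split_rowK_kernel.
Qed.

Lemma stably_free_colon : stably_free I.
Proof. by exists 1, 2, split_row; exact: split_row_bij. Qed.

End StablyFree.

(** Every l in I is r1 l + r2 b with fixed r1 and r2, where x l = y b.  As eps
    kills x and not y, it kills b, so eps of the coordinate of l along a basis
    vector j is a constant, depending on j alone, times eps l.  The matrix of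
    coordinates of the basis vectors is the identity, and eps turns it into a
    matrix of rank at most 1: the basis has at most one element. *)
Lemma free_colon_principal (F : fieldType) (eps : {rmorphism S -> F}) :
    eps x = 0 -> free_module I ->
  exists g : S, in_colon g /\ forall a, in_colon a -> exists t, a = g * t.
Proof.
move=> eps_x [J [f [f' fK f'K]]].
have epsy : eps y * eps q = 1.
  by rewrite -(rmorph1 eps) -xpyq rmorphD !rmorphM eps_x mul0r add0r.
have eps_quot l : eps (quot_by l) = 0.
  have := congr1 eps (quot_byP l); rewrite !rmorphM eps_x mul0r => /esym/eqP.
  rewrite mulf_eq0 => /orP[/eqP y0|/eqP//].
  by move/eqP: epsy; rewrite y0 mul0r eq_sym oner_eq0.
have /colonP r1I := in_colon_complement; have /colonP r2I := in_colon_mulr.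
pose R1 : I := Submodule r1I; pose R2 : I := Submodule r2I.
have decomp (l : I) : l = (val l : S^c) *: R1 + (quot_by l : S^c) *: R2.
  apply: val_inj; rewrite [RHS]/=.
  have -> : (val l : S) = (1 - p * x) * (val l : S) + p * y * quot_by l.
    by rewrite mulrBl mul1r -!mulrA quot_byP subrK.
  by [].
have f'_comb (c d : S^c) l1 l2 : f' (c *: l1 + d *: l2) = c *: f' l1 + d *: f' l2.
  by apply: (can_inj fK); rewrite f'K linearP linearZ /= !f'K.
have coord l j : eps ((f' l)@_j) = eps ((f' R1)@_j) * eps (val l).
  rewrite {1}(decomp l) f'_comb mcoeffD !mcoeffZ.
  transitivity (eps (((f' R1)@_j : S) * (val l : S) +
    ((f' R2)@_j : S) * quot_by l)); first exact: erefl.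
  by rewrite rmorphD !rmorphM eps_quot mulr0 addr0.
have J_subsingleton (i j : J) : i = j.
  apply/eqP/negPn/negP => ne_ij.
  have cii := coord (f << i >>) i; have cij := coord (f << i >>) j.
  have cjj := coord (f << j >>) j; move: cii cij cjj.
  rewrite !fK !mcoeffUU mcoeffU (negPf ne_ij) /= !(rmorph1 eps) (rmorph0 eps).
  move=> cii /esym/eqP; rewrite mulf_eq0 => /orP[]/eqP z.
    by rewrite z mul0r => /eqP; rewrite oner_eq0.
  by move/eqP: cii; rewrite z mulr0 oner_eq0.
(* A free module on the empty set is zero, hence generated by 0. *)
have [[j0 _]|noJ] := pselect (exists j : J, True).
  exists (val (f << j0 >>)); split; first exact: colon_val.
  move=> a /colonP aI; pose l : I := Submodule aI; exists ((f' l)@_j0).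
  have -> : a = val (f (f' l)) by rewrite f'K.
  have {1}-> : f' l = (f' l)@_j0 *: << j0 >>.
    apply/malgP => j; rewrite (J_subsingleton j j0) mcoeffZ mcoeffUU.
    by rewrite mulr1.
  rewrite linearZ GRing.valZ; reflexivity.
exists 0; split; first by exists 0; rewrite !mulr0.
move=> a /colonP aI; exists 0; rewrite mulr0.
have -> : a = val (f (f' (Submodule aI))) by rewrite f'K.
have -> : f' (Submodule aI) = 0 by apply/malgP => j; case: noJ; exists j.
by rewrite linear0.
Qed.

End ColonIdeal.

(** * The augmentation *)

Section Augmentation.
Variables (k : fieldType) (al be ga : k).
Local Notation A := (downup al be ga).

Let zero_fun (c : k^o) : k^o := 0.

Let zero_linear : linear zero_fun.
Proof. by move=> c p q; rewrite /zero_fun scaler0 addr0. Qed.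

Let zero_rel (v : k^o) : zero_fun (zero_fun (zero_fun v)) =
  al *: zero_fun (zero_fun (zero_fun v)) +
  be *: zero_fun (zero_fun (zero_fun v)) + ga *: zero_fun v.
Proof. by rewrite /zero_fun !scaler0 !addr0. Qed.

Definition augmentation (a : A) : k := downup_act zero_fun zero_fun 1 a.

Let augmentation_linear : linear (augmentation : A -> k^o).
Proof. exact: (downup_act_linear zero_linear zero_linear zero_rel zero_rel). Qed.

Let augmentation_additive : zmod_morphism augmentation.
Proof. exact: (linear_funB augmentation_linear). Qed.

Let augmentation_monoid : monoid_morphism augmentation.
Proof.
split=> [|a b]; rewrite /augmentation.
  exact: (downup_act1 zero_linear zero_linear zero_rel zero_rel).
rewrite (downup_actM zero_linear zero_linear zero_rel zero_rel).
set c := downup_act _ _ _ a.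
have {1}-> : c = c *: (1 : k^o) by rewrite /GRing.scale /= mulr1.
exact: (linear_funZ (downup_act_linearl zero_linear zero_linear b)).
Qed.
HB.instance Definition _ :=
  GRing.isZmodMorphism.Build A k augmentation augmentation_additive.
HB.instance Definition _ :=
  GRing.isMonoidMorphism.Build A k augmentation augmentation_monoid.

Lemma augmentationU : augmentation (downupU al be ga) = 0.
Proof. exact: (downup_actU zero_linear zero_linear zero_rel zero_rel). Qed.

Lemma augmentationW r : augmentation (downupW al be ga r) = 0.
Proof.
rewrite /downupW -mulr_algl rmorphB !rmorphM /= augmentationU.
by rewrite !(mulr0, mul0r) subrr.
Qed.

End Augmentation.

(** * The polynomial ring k[h0, h1] and its automorphism *)

Section PolynomialModel.
Import mpoly.
Variables (k : fieldType) (al be ga : k).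
Hypothesis be_neq0 : be != 0.
Local Notation P := {mpoly k[2]}.
Local Notation h0 := ('X_ord0 : P).
Local Notation h1 := ('X_ord_max : P).

Definition shift_tuple : 2.-tuple P :=
  [tuple h1; al *: h1 + be *: h0 + ga%:A].
Definition unshift_tuple : 2.-tuple P :=
  [tuple be^-1 *: (h1 - al *: h0 - ga%:A); h0].

Definition model_sig : {lrmorphism P -> P} := comp_mpoly shift_tuple.
Definition model_tau : {lrmorphism P -> P} := comp_mpoly unshift_tuple.

Lemma mpoly2_ext (f g : {lrmorphism P -> P}) :
  f h0 = g h0 -> f h1 = g h1 -> f =1 g.
Proof.
move=> e0 e1 p; rewrite (mpolyE p) !linear_sum; apply: eq_bigr => m _.
rewrite !linearZ /= !mpolyXE_id !rmorph_prod; congr (_ *: _); apply: eq_bigr => i _.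
rewrite !rmorphXn; congr (_ ^+ _).
by have [->|->] : i = ord0 \/ i = ord_max;
  first by case: i => [[|[|//]] ?]; [left|right]; apply: val_inj.
Qed.

Lemma model_sig0 : model_sig h0 = h1.
Proof. by rewrite /model_sig /= comp_mpolyXU. Qed.

Lemma model_sig1 : model_sig h1 = al *: h1 + be *: h0 + ga%:A.
Proof. by rewrite /model_sig /= comp_mpolyXU. Qed.

Lemma model_tau0 : model_tau h0 = be^-1 *: (h1 - al *: h0 - ga%:A).
Proof. by rewrite /model_tau /= comp_mpolyXU. Qed.

Lemma model_tau1 : model_tau h1 = h0.
Proof. by rewrite /model_tau /= comp_mpolyXU. Qed.

Lemma model_sigK : cancel model_sig model_tau.
Proof.
apply: (@mpoly2_ext (model_tau \o model_sig) idfun) => /=.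
  by rewrite model_sig0 model_tau1.
rewrite model_sig1 !linearD !linearZ /= rmorph1 model_tau0 model_tau1.
by rewrite scalerA divff // scale1r addrA subrK addrC subrK.
Qed.

Lemma model_tauK : cancel model_tau model_sig.
Proof.
apply: (@mpoly2_ext (model_sig \o model_tau) idfun) => /=.
  rewrite model_tau0 linearZ !linearB !linearZ /= rmorph1 model_sig0 model_sig1.
  rewrite !scalerN addrAC addrK addrAC subrr add0r.
  by rewrite scalerA mulVf // scale1r.
by rewrite model_tau1 model_sig0.
Qed.

Lemma model_domain (p q : P) : p * q = 0 -> p = 0 \/ q = 0.
Proof. by move/eqP; rewrite mulf_eq0 => /orP[]/eqP; [left|right]. Qed.

(** Evaluation at the origin sends this polynomial to 0. *)
Lemma model_nunit r : h1 - r *: h0 \isn't a GRing.unit.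
Proof.
apply/negP => /(rmorph_unit (meval (fun _ : 'I_2 => 0 : k))).
by rewrite /= mevalB mevalZ !mevalXU mulr0 subr0 unitr0.
Qed.

Lemma no_common_generator r s g b t1 t2 :
    al = r + s -> be = - (r * s) -> ga != 0 ->
    downupW al be ga r * g = (downupU al be ga - 1) * b ->
    colon_gen1 al be ga r s = g * t1 -> colon_gen2 al be ga s = g * t2 ->
  False.
Proof.
move=> al_rs be_rs ga_neq0.
apply: (no_generator (h := h0) model_domain model_sigK model_tauK _ al_rs be_rs ga_neq0).
  by rewrite model_sig0 model_sig1.
by rewrite model_sig0; exact: model_nunit.
Qed.

End PolynomialModel.

(** * The theorem *)

Lemma quadratic_roots (k : fieldType) (alpha beta r s : k) :
    'X^2 - alpha *: 'X - beta%:P = ('X - r%:P) * ('X - s%:P) ->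
  alpha = r + s /\ beta = - (r * s).
Proof.
rewrite mulrBl !mulrBr => rs; split.
  have := congr1 (fun f : {poly k} => - f`_1) rs; rewrite !coefE /=.
  have {2}-> : alpha = - (0 - alpha * 1 - 0) by ring.
  by move=> ->; ring.
have := congr1 (fun f : {poly k} => - f`_0) rs; rewrite !coefE /=.
have {2}-> : beta = - (0 - alpha * 0 - beta) by ring.
by move=> ->; ring.
Qed.

Theorem corollary3p6 (k : fieldType) (alpha beta gamma : k)
  (char_k : [pchar k] =i pred0)
  (beta_neq0 : beta != 0)
  (roots : exists r s : k,
     'X^2 - alpha *: 'X - beta%:P = ('X - r%:P) * ('X - s%:P))
  (gamma_neq0 : gamma != 0) :
  exists I : right_ideal (downup alpha beta gamma),
    nontrivial_stably_free_right_ideal I.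
Proof.
have [r [s /quadratic_roots[al_rs be_rs]]] := roots.
pose U := downupU alpha beta gamma; pose W := downupW alpha beta gamma r.
pose p := gamma^-1 *: (U - s%:A).
pose q := - (gamma^-1 *: (s *: W + gamma%:A)).
have unimodular : W * p + (U - 1) * q = 1.
  rewrite /p /q mulrN -!scalerAr -scalerBr [W * _]mulrBr mulr_algr.
  rewrite [(U - 1) * _]mulrBl mul1r.
  rewrite -(downup_WU _ al_rs be_rs) opprB addrC addrA subrK addrAC subrr add0r.
  by rewrite scalerA mulVf // scale1r.
exists (colon_ideal W (U - 1)); split.
  by apply: (stably_free_colon unimodular); exact: lreg_U_sub1.
move=> /(free_colon_principal unimodular (eps := @augmentation k _ _ _)) [].
  exact: augmentationW.
move=> g [[b gb] gen].
have [t1 e1] := gen _ (in_colon_complement unimodular).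
have [t2 e2] := gen _ (in_colon_mulr unimodular).
(* p W - 1 and p (U - 1) are colon_gen1 and colon_gen2 divided by gamma. *)
apply: (no_common_generator beta_neq0 al_rs be_rs gamma_neq0 gb
  (t1 := t1 * - gamma%:A) (t2 := t2 * gamma%:A)).
  rewrite mulrA -e1 mulrN mulr_algr /p -scalerAl.
  rewrite scalerBr scalerA mulfV // scale1r mulrBl opprB -scalerAl mul1r.
  by rewrite /colon_gen1 opprD addrA.
by rewrite mulrA -e2 mulr_algr /p -scalerAl scalerA mulfV // scale1r.
Qed.
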